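(* Let $X_1,\dots,X_n$ ($n\ge 1$) be finite posets and let $X=X_1\oplus X_2\oplus\cdots\oplus X_n$ be their ordinal sum. Then \[ \phi_X(x)=\sum_{k=0}^n v_{n+1-k}(x)\cdot\Phi_k(x), \] and \[ \phi^0_X(x)=\sum_{k=0}^n v_{n-k}(x)\cdot\Phi_k(x),\qquad \phi^1_X(x)=\sum_{k=0}^n(-x)\cdot v_{n-1-k}(x)\cdot\Phi_k(x), \] where $v_m(x)=(x^m-1)/(x-1)$ for $m\ge 0$, $v_{-1}(x)=-x^{-1}$, and for $0\le k\le n$ \[ \Phi_k(x)=\sum_{\varepsilon\in\{0,1\}^n,\ |\varepsilon|=k}\phi^{\varepsilon_1}_{X_1}(x)\cdot\phi^{\varepsilon_2}_{X_2}(x)\cdots\phi^{\varepsilon_n}_{X_n}(x),\qquad |\varepsilon|=\varepsilon_1+\cdots+\varepsilon_n. \]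
   Context: For a finite poset $S$, let $C_S$ be the $S\times S$ matrix with $(C_S)_{st}=1$ if $t\le s$ and $0$ otherwise (the Cartan matrix of the incidence algebra $KS$ over any field $K$). The Coxeter polynomial of $S$ is $\phi_S(x)=\det(xC_S+C_S^T)$, with $\phi_\varnothing=1$. Refined Coxeter polynomials $\phi^0_S,\phi^1_S\in\mathbb{Z}[x]$: if $S=\varnothing$, $\phi^0_S=0$ and $\phi^1_S=1$. If $S\neq\varnothing$, choose $s\in S$, put $S'=S\setminus\{s\}$, and let $A$ be the matrix obtained from $xC_S+C_S^T$ by subtracting the $s$-th row from all other rows and then subtracting the $s$-th column from all other columns; then \[ \phi^0_S(x)=\sum_{\sigma\in\Sigma_{S'}}\mathrm{sgn}(\sigma)\prod_{i\in S'}A_{i\sigma(i)},\qquad \phi^1_S(x)=\sum_{\sigma\in\Sigma_S,\ \sigma(s)\ne s}\mathrm{sgn}(\sigma)\prod_{i\in S}A_{i\sigma(i)}, \] where $\Sigma_{S'},\Sigma_S$ are the permutation groups of $S'$ and $S$; these do not depend on the choice of $s$. The ordinal sum $X_1\oplus\cdots\oplus X_n$ of posets $(X_i,\le_i)$ is the disjoint union of the $X_i$ with $x\le y$ (for $x\in X_i$, $y\in X_j$) if and only if $i<j$, or $i=j$ and $x\le_i y$. *)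

(* Defs.v *)
From mathcomp Require Import all_boot all_order all_fingroup all_algebra.

Set Implicit Arguments.
Unset Strict Implicit.
Unset Printing Implicit Defensive.

Import Order.TTheory GRing.Theory Num.Theory.
Local Open Scope ring_scope.

Notation "x %:F" := (tofrac x) (format "x %:F") : ring_scope.

(* S x S matrices are indexed by 'I_#|S| through the enumeration of S;
   [enum_rank s] is the index of s : S. *)
Definition cartan_mx d (S : finPOrderType d) : 'M[int]_#|S| :=
  \matrix_(s, t) ((enum_val t <= enum_val s)%O : nat)%:R.

Definition coxeter_mx d (S : finPOrderType d) : 'M[{poly int}]_#|S| :=
  let C := map_mx polyC (cartan_mx S) in 'X *: C + C^T.

Definition coxeter_poly d (S : finPOrderType d) : {poly int} :=
  \det (coxeter_mx S).

Definition sub_row (R : nzRingType) n (s : 'I_n) (M : 'M[R]_n) : 'M[R]_n :=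
  \matrix_(i, j) if i == s then M i j else M i j - M s j.

Definition sub_col (R : nzRingType) n (s : 'I_n) (M : 'M[R]_n) : 'M[R]_n :=
  \matrix_(i, j) if j == s then M i j else M i j - M i s.

Definition reduced_coxeter_mx d (S : finPOrderType d) (s : S) :
    'M[{poly int}]_#|S| :=
  sub_col (enum_rank s) (sub_row (enum_rank s) (coxeter_mx S)).

(* [Sym [set~ r]] is the group of permutations of S \ {s}, extended by s |-> s,
   which does not affect the sign. *)
Definition refined_coxeter0_at d (S : finPOrderType d) (s : S) : {poly int} :=
  let A := reduced_coxeter_mx s in
  let r := enum_rank s in
  \sum_(sigma in Sym [set~ r])
    (-1) ^+ sigma * \prod_(i in [set~ r]) A i (sigma i).

Definition refined_coxeter1_at d (S : finPOrderType d) (s : S) : {poly int} :=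
  let A := reduced_coxeter_mx s in
  let r := enum_rank s in
  \sum_(sigma : 'S_#|S| | sigma r != r)
    (-1) ^+ sigma * \prod_i A i (sigma i).

Definition refined_coxeter0 d (S : finPOrderType d) : {poly int} :=
  if [pick s : S] is Some s then refined_coxeter0_at s else 0.

Definition refined_coxeter1 d (S : finPOrderType d) : {poly int} :=
  if [pick s : S] is Some s then refined_coxeter1_at s else 1.

Definition refined_coxeter d (S : finPOrderType d) (e : bool) : {poly int} :=
  if e then refined_coxeter1 S else refined_coxeter0 S.

(* The order on the sigma type is the lexicographic one, where the index is
   compared first: this is the order of X_0 (+) ... (+) X_(n-1). *)
Definition ordinal_sum d n (X : 'I_n -> finPOrderType d) : finPOrderType d :=
  {i : 'I_n & X i}.

Lemma le_ordinal_sum d n (X : 'I_n -> finPOrderType d) (x y : ordinal_sum X) :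
  (x <= y)%O <->
  (tag x < tag y)%N \/
  exists e : tag x = tag y, (ecast i (X i) e (tagged x) <= tagged y)%O.
Proof.
case: x y => [i x] [j y]; rewrite leEsig /=; split.
  case: (ltngtP i j) => [lt_ij|lt_ji|/val_inj eq_ij].
  - by left.
  - by rewrite [(i <= j)%O]leqNgt lt_ji.
  - by case: _ / eq_ij in y *; rewrite lexx tagged_asE; right; exists erefl.
case=> [lt_ij|[e]].
  by rewrite [(i <= j)%O](ltnW lt_ij) [(j <= i)%O]leqNgt lt_ij.
by case: _ / e in y *; rewrite /= lexx tagged_asE.
Qed.

Section BasePoint.
Variables (R : comNzRingType) (n : nat) (s : 'I_n).
Implicit Type M : 'M[R]_n.

Let P : 'M[R]_n := \matrix_(i, j) ((i == j)%:R - ((i != s) && (j == s))%:R).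

Lemma sub_rowE M : sub_row s M = P *m M.
Proof.
apply/matrixP=> i j; rewrite !mxE.
under eq_bigr do rewrite mxE mulrBl.
rewrite big_split /= (bigD1 i) //= eqxx mul1r big1 ?addr0; last first.
  by move=> k /negPf; rewrite eq_sym => ->; rewrite mul0r.
rewrite (bigD1 s) //= eqxx andbT big1 ?addr0; last first.
  by move=> k /negPf ->; rewrite andbF mul0r oppr0.
by case: (i == s); rewrite /= ?mul0r ?mul1r ?oppr0 ?addr0.
Qed.

Lemma sub_colE M : sub_col s M = M *m P^T.
Proof.
apply: trmx_inj; rewrite trmx_mul trmxK -sub_rowE.
by apply/matrixP=> i j; rewrite !mxE.
Qed.

Lemma det_subP : \det P = 1.
Proof.
rewrite (expand_det_row _ s) (bigD1 s) //= mxE !eqxx /= subr0 mul1r.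
rewrite big1 ?addr0; last first.
  by move=> j /negPf; rewrite mxE eqxx eq_sym => ->; rewrite subr0 mul0r.
rewrite /cofactor -signr_odd oddD addbb expr0 mul1r -[RHS](det1 R n.-1).
congr (\det _); apply/matrixP=> i j; rewrite !mxE (inj_eq lift_inj).
by rewrite [lift s j == s]eq_sym (negPf (neq_lift s j)) andbF subr0.
Qed.

Lemma det_sub_col_row M : \det (sub_col s (sub_row s M)) = \det M.
Proof. by rewrite sub_colE sub_rowE !det_mulmx det_tr det_subP mul1r mulr1. Qed.

Lemma mem_SymC1 (sigma : 'S_n) : (sigma \in Sym [set~ s]) = (sigma s == s).
Proof.
rewrite inE; apply/subsetP/eqP => [on_s | fix_s i].
  by apply/eqP; apply: contraTT isT => /on_s; rewrite !inE eqxx.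
by rewrite !inE; apply: contraNN => /eqP->; rewrite fix_s.
Qed.

Lemma refined0_det M (A := sub_col s (sub_row s M)) :
  \sum_(sigma in Sym [set~ s])
    (-1) ^+ sigma * \prod_(i in [set~ s]) A i (sigma i)
  = \det (M + const_mx 1) - \det M.
Proof.
apply/eqP; rewrite eq_sym subr_eq -(det_sub_col_row M) -det_sub_col_row.
have -> : sub_col s (sub_row s (M + const_mx 1)) = A + delta_mx s s.
  have subK1 (a b : R) : a + 1 - (b + 1) = a - b.
    by rewrite opprD addrACA subrr addr0.
  apply/matrixP=> i j; rewrite !mxE.
  by case: (i == s); case: (j == s); rewrite /= ?subK1 ?addr0.
rewrite /determinant (bigID (fun sigma : 'S_n => sigma s == s)) /=.
rewrite [X in _ == _ + X](bigID (fun sigma : 'S_n => sigma s == s)) /= addrA.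
apply/eqP; congr (_ + _); last first.
  apply: eq_bigr => sigma ns; congr (_ * _); apply: eq_bigr => i _.
  rewrite !mxE; case: (i =P s) => [->|]; last by rewrite addr0.
  by rewrite (negPf ns) addr0.
rewrite (eq_bigl _ _ mem_SymC1) -big_split; apply: eq_bigr => sigma /eqP fs /=.
rewrite -mulrDr; congr (_ * _).
rewrite (bigD1 s) //= [in X in _ = _ + X](bigD1 s) //= fs.
rewrite [(A + _) s s]mxE [delta_mx _ _ _ _]mxE !eqxx mulrDl mul1r addrC; congr (_ + _).
  apply: eq_big => [i|i /negPf ni]; first by rewrite !inE.
  by rewrite !mxE ni addr0.
by congr (_ * _); apply: eq_bigr => i /negPf ni; rewrite !mxE ni addr0.
Qed.

Lemma refined1_det M (A := sub_col s (sub_row s M)) :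
  \sum_(sigma : 'S_n | sigma s != s) (-1) ^+ sigma * \prod_i A i (sigma i)
  = \det M - M s s * (\det (M + const_mx 1) - \det M).
Proof.
apply/eqP; rewrite -refined0_det eq_sym subr_eq -(det_sub_col_row M) addrC.
rewrite /determinant (bigID (fun sigma : 'S_n => sigma s == s)) /=.
apply/eqP; congr (_ + _); rewrite mulr_sumr (eq_bigl _ _ mem_SymC1).
apply: eq_bigr => sigma /eqP fs; rewrite (bigD1 s) //= fs mulrCA.
rewrite [sub_col _ _ s s]mxE eqxx mxE eqxx; congr (_ * (_ * _)).
by apply: eq_bigl => i; rewrite !inE.
Qed.

End BasePoint.

(* The refined Coxeter polynomials do not depend on the chosen element. *)

Lemma refined_coxeter0E d (S : finPOrderType d) (s : S) :
  refined_coxeter0 S = refined_coxeter0_at s.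
Proof.
rewrite /refined_coxeter0; case: pickP => [t _|/(_ s)//].
by rewrite /refined_coxeter0_at /reduced_coxeter_mx !refined0_det.
Qed.

Lemma refined_coxeter1E d (S : finPOrderType d) (s : S) :
  refined_coxeter1 S = refined_coxeter1_at s.
Proof.
rewrite /refined_coxeter1; case: pickP => [t _|/(_ s)//].
by rewrite /refined_coxeter1_at /reduced_coxeter_mx !refined1_det !mxE !lexx.
Qed.

(* The polynomial identities live in the fraction field of int[X], as v_(-1)
   is not a polynomial; [v m] is not used for m < -1. *)
Definition v (m : int) : {fraction {poly int}} :=
  if m == -1 then - ('X%:F)^-1 else ('X%:F ^ m - 1) / ('X%:F - 1).

Definition Phi d n (X : 'I_n -> finPOrderType d) (k : nat) : {poly int} :=
  \sum_(e : {ffun 'I_n -> bool} | (\sum_i e i)%N == k)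
    \prod_i refined_coxeter (X i) (e i).

(* Main.v *)
Require Import Defs.
From mathcomp Require Import all_boot all_order all_fingroup all_algebra.
From mathcomp Require Import ring.

Import Order.TTheory GRing.Theory Num.Theory.
Local Open Scope ring_scope.

(** Write [M] for the matrix [x C + C^T] of a poset [S] and [J] for the
    all-ones matrix. Adding [t J] to [M] becomes, after the row and column
    subtractions at a base point [s], adding [t] to the single entry [(s, s)];
    hence [det (M + t J)] is affine in [t], with slope [phi^0] ([det_addJ]).
    Since the diagonal entries of [M] are [x + 1], one also has
    [phi = phi^1 + (x + 1) phi^0] ([coxeter_poly_refined]), and so
<<
      det (M - J)   = phi^1 + x phi^0,      det (M - x J) = phi^1 + phi^0.
>>
    In an ordinal sum, the entries of [M] between a lower and a higher summand
    are all [1] on one side of the diagonal and all [x] on the other side.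
    Subtracting [J], or [x J], makes one of the two sides vanish, and [M]
    becomes block triangular; the diagonal blocks are the corresponding
    matrices of the summands. Both polynomials above are therefore
    multiplicative on ordinal sums ([refined_coxeter_mul_X],
    [refined_coxeter_mul_1]). Equivalently, [S |-> phi^1 + phi^0 w] turns
    ordinal sums into products modulo [w ^ 2 = (x + 1) w - x], a polynomial
    whose roots are [1] and [x].

    Expanding the product of the [phi^1 + z phi^0] over the summands gives
    the sum of the [z ^ (n - k) Phi_k] ([prod_Phi]). For [z = x] and [z = 1],
    this is a linear system of determinant [x - 1] for [phi^0] and [phi^1]
    of the ordinal sum, and its solution is the stated formula
    ([refined_of_sums]). *)

(** * Determinants of matrices indexed by finite types *)

Definition det_on {R : comNzRingType} {T : finType} (F : T -> T -> R) : R :=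
  \det (\matrix_(i < #|T|, j < #|T|) F (enum_val i) (enum_val j)).

(** Rows and columns are permuted simultaneously, so the two signs cancel. *)
Lemma det_reindex {R : comNzRingType} {T : finType} {m} (f : 'I_m -> T)
    (F : T -> T -> R) :
  bijective f -> \det (\matrix_(i, j) F (f i) (f j)) = det_on F.
Proof.
move=> bij_f.
have eq_m : m = #|T| by rewrite -(bij_eq_card bij_f) card_ord.
case: _ / (esym eq_m) in f bij_f *; rewrite /det_on.
have inj_s : injective (fun i => enum_rank (f i)).
  exact: inj_comp enum_rank_inj (bij_inj bij_f).
set B := \matrix_(i, j) F (enum_val i) _.
have -> : \matrix_(i, j) F (f i) (f j)
    = row_perm (perm inj_s) (col_perm (perm inj_s) B).
  by apply/matrixP=> i j; rewrite !mxE !permE !enum_rankK.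
rewrite row_permE col_permE !det_mulmx !det_perm odd_permV mulrC -mulrA.
by rewrite -signr_addb addbb mulr1.
Qed.

Lemma eq_det_on {R : comNzRingType} {T : finType} (F G : T -> T -> R) :
  F =2 G -> det_on F = det_on G.
Proof.
by move=> eqFG; congr (\det _); apply/matrixP=> i j; rewrite !mxE eqFG.
Qed.

Lemma det_on_tr {R : comNzRingType} {T : finType} (F : T -> T -> R) :
  det_on (fun x y => F y x) = det_on F.
Proof.
by rewrite /det_on -det_tr; congr (\det _); apply/matrixP=> i j; rewrite !mxE.
Qed.

(** Block triangular matrices with any number of blocks: splitting off the
    block of index [0] leaves a block triangular matrix over the family
    [i |-> T (lift ord0 i)], to which induction applies. *)
Lemma det_on_lower {R : comNzRingType} {n} (T : 'I_n -> finType)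
    (F : {i & T i} -> {i & T i} -> R) :
  (forall x y : {i & T i}, (tag x < tag y)%N -> F x y = 0) ->
  det_on F = \prod_i det_on (fun a b : T i => F (Tagged T a) (Tagged T b)).
Proof.
elim: n T F => [|n IHn] T F F0.
  rewrite big_ord0 /det_on.
  have T0 : #|{: {i & T i}}| = 0%N by apply: eq_card0 => -[[]].
  by move: (\matrix_(i, j) _); rewrite T0 => A; rewrite det_mx00.
(* [up] embeds the remaining summands; [f] lists the first one before them. *)
pose T' i := T (lift ord0 i).
pose up (y : {i & T' i}) : {i & T i} := Tagged T (tagged y : T (lift ord0 (tag y))).
rewrite big_ord_recl -(IHn T' (fun x y => F (up x) (up y))); last first.
  by move=> x y lt_xy; apply: F0.
pose g (u : 'I_#|T ord0| + 'I_#|{: {i & T' i}}|) : {i & T i} :=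
  match u with inl a => Tagged T (enum_val a) | inr b => up (enum_val b) end.
pose f i := g (split i).
have bij_f : bijective f.
  apply: bij_comp; last by exists unsplit; [apply: splitK | apply: unsplitK].
  have inj_g : injective g.
    move=> [a|b] [a'|b'] //=.
    - by move/eqP; rewrite eq_Tagged /= => /eqP/enum_val_inj->.
    - move=> eq_ab; congr inr; apply: enum_val_inj.
      case: (enum_val b) (enum_val b') eq_ab => [i x] [j y] eq_xy.
      have eq_ij : i = j by apply: (@lift_inj _ ord0); apply: (congr1 tag eq_xy).
      case: _ / eq_ij in y eq_xy *.
      by move/eqP: eq_xy; rewrite eq_Tagged /= => /eqP->.
  apply: inj_card_bij => //.
  have sub : forall x : {i & T i}, exists u, g u = x.
    move=> [i x]; case: (unliftP ord0 i) x => [j ->|->] x.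
      by exists (inr (enum_rank (Tagged T' x))); rewrite /= enum_rankK.
    by exists (inl (enum_rank x)); rewrite /= enum_rankK.
  rewrite -(card_codom inj_g); apply/subset_leq_card/subsetP=> x _.
  by have [u <-] := sub x; apply: codom_f.
pose Adl := \matrix_(i < #|{: {i & T' i}}|, j < #|T ord0|)
  F (up (enum_val i)) (Tagged T (enum_val j)).
rewrite -(det_reindex f F bij_f) -(det_lblock _ Adl); congr (\det _).
apply/matrixP=> i j; rewrite !mxE /f.
case: split => a; rewrite !mxE; case: split => b; rewrite !mxE //=.
exact: F0.
Qed.

(** * Refined Coxeter polynomials as determinants *)

(** After the base-point subtractions, the perturbation [t J] sits in a single
    entry, and the determinant is linear in the row of that entry. *)
Lemma det_addJ {R : comNzRingType} {n} (M : 'M[R]_n) (t : R) :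
  \det (M + const_mx t) = \det M + t * (\det (M + const_mx 1) - \det M).
Proof.
case: n M => [|n] M; first by rewrite !det_mx00 subrr mulr0 addr0.
have pivotE u : sub_col ord0 (sub_row ord0 (M + const_mx u))
    = sub_col ord0 (sub_row ord0 M) + u *: delta_mx ord0 ord0.
  apply/matrixP=> i j; rewrite !mxE.
  by case: eqP => _; case: eqP => _ /=; ring.
rewrite -[in LHS](det_sub_col_row ord0) -[\det (M + const_mx 1)](det_sub_col_row ord0).
rewrite -(det_sub_col_row ord0 M) !pivotE.
set A := sub_col _ _.
have row'_delta u : row' ord0 (A + u *: delta_mx ord0 ord0) = row' ord0 A.
  apply/matrixP=> i j; move: A => A.
  by rewrite !mxE eq_sym (negPf (neq_lift _ _)) mulr0 addr0.
(* The pivot row for [t] is the affine combination, with weights [1 - t] and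
   [t], of the pivot rows for [0] and [1]. *)
rewrite (@determinant_multilinear _ _ _ A (A + 1 *: delta_mx ord0 ord0)
  ord0 (1 - t) t) ?row'_delta //; first by ring.
by apply/rowP=> j; move: A {row'_delta} => A; rewrite !mxE; ring.
Qed.

Lemma refined_coxeter0_det {d} (S : finPOrderType d) :
  refined_coxeter0 S = \det (coxeter_mx S + const_mx 1) - coxeter_poly S.
Proof.
rewrite /refined_coxeter0; case: pickP => [s _|S0]; first exact: refined0_det.
rewrite /coxeter_poly; move: (coxeter_mx S).
have -> : #|S| = 0%N by apply: eq_card0.
by move=> A; rewrite !det_mx00 subrr.
Qed.

(** Permutations fixing the base point contribute the pivot [x + 1] times
    [phi^0]; the others contribute [phi^1]. *)
Lemma coxeter_poly_refined {d} (S : finPOrderType d) :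
  coxeter_poly S = refined_coxeter1 S + ('X + 1) * refined_coxeter0 S.
Proof.
rewrite /refined_coxeter1; case: pickP => [s _|S0].
  rewrite /refined_coxeter1_at /reduced_coxeter_mx refined1_det.
  by rewrite refined_coxeter0_det /coxeter_poly !mxE lexx mulr1 subrK.
rewrite refined_coxeter0_det /coxeter_poly; move: (coxeter_mx S).
have -> : #|S| = 0%N by apply: eq_card0.
by move=> A; rewrite !det_mx00 subrr mulr0 addr0.
Qed.

(** The entries of [x C + C^T - t J], indexed by the poset itself, so that
    these matrices for an ordinal sum and for its summands can be compared
    without mentioning enumerations. *)
Definition coxeter_kernel {d} (S : finPOrderType d) (t : {poly int}) (a b : S) :=
  'X * ((b <= a)%O : nat)%:R + ((a <= b)%O : nat)%:R - t.

Lemma det_coxeter_kernel {d} (S : finPOrderType d) (t : {poly int}) :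
  det_on (coxeter_kernel S t)
    = refined_coxeter1 S + ('X + 1 - t) * refined_coxeter0 S.
Proof.
transitivity (\det (coxeter_mx S + const_mx (- t))).
  congr (\det _); apply/matrixP=> i j; rewrite !mxE /coxeter_kernel.
  by rewrite !rmorph_nat.
rewrite det_addJ -/(coxeter_poly S) -refined_coxeter0_det coxeter_poly_refined.
by ring.
Qed.

(** * Multiplicativity on ordinal sums *)

Lemma ordinal_sum_le_tag {d n} (X : 'I_n -> finPOrderType d)
    (x y : ordinal_sum X) :
  (tag x < tag y)%N -> ((x <= y)%O = true) * ((y <= x)%O = false).
Proof.
move=> lt_xy; split; first by apply/le_ordinal_sum; left.
apply/negP=> /le_ordinal_sum[|[e _]]; first by rewrite ltnNge (ltnW lt_xy).
by rewrite e ltnn in lt_xy.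
Qed.

Lemma ordinal_sum_le_Tagged {d n} (X : 'I_n -> finPOrderType d) i (a b : X i) :
  (Tagged X a <= Tagged X b :> ordinal_sum X)%O = (a <= b)%O.
Proof. by rewrite leEsig /= lexx tagged_asE. Qed.

Lemma coxeter_kernel_Tagged {d n} (X : 'I_n -> finPOrderType d) t i (a b : X i) :
  coxeter_kernel (ordinal_sum X) t (Tagged X a) (Tagged X b)
    = coxeter_kernel (X i) t a b.
Proof. by rewrite /coxeter_kernel !ordinal_sum_le_Tagged. Qed.

(** [M - J] is block lower triangular: a row in a lower summand and a column
    in a higher one meet at an entry [1] of [M]. *)
Lemma refined_coxeter_mul_X {d n} (X : 'I_n -> finPOrderType d) :
  refined_coxeter1 (ordinal_sum X) + 'X * refined_coxeter0 (ordinal_sum X)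
    = \prod_i (refined_coxeter1 (X i) + 'X * refined_coxeter0 (X i)).
Proof.
have E (S : finPOrderType d) :
    refined_coxeter1 S + 'X * refined_coxeter0 S = det_on (coxeter_kernel S 1).
  by rewrite det_coxeter_kernel addrK.
rewrite E (det_on_lower (fun i => X i : finType)) => [|x y lt_xy].
  apply: eq_bigr => i _; rewrite E; apply: eq_det_on => a b.
  exact: coxeter_kernel_Tagged.
by rewrite /coxeter_kernel !(ordinal_sum_le_tag X x y lt_xy) mulr0 add0r subrr.
Qed.

(** [M - x J] is block upper triangular, for the symmetric reason: below the
    diagonal blocks the entries of [M] are [x]. *)
Lemma refined_coxeter_mul_1 {d n} (X : 'I_n -> finPOrderType d) :
  refined_coxeter1 (ordinal_sum X) + refined_coxeter0 (ordinal_sum X)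
    = \prod_i (refined_coxeter1 (X i) + refined_coxeter0 (X i)).
Proof.
have E (S : finPOrderType d) :
    refined_coxeter1 S + refined_coxeter0 S
      = det_on (fun a b => coxeter_kernel S 'X b a).
  by rewrite (det_on_tr (coxeter_kernel S 'X)) det_coxeter_kernel addrAC subrr
     add0r mul1r.
rewrite E (det_on_lower (fun i => X i : finType)) => [|x y lt_xy].
  apply: eq_bigr => i _; rewrite E; apply: eq_det_on => a b.
  exact: coxeter_kernel_Tagged.
by rewrite /coxeter_kernel !(ordinal_sum_le_tag X x y lt_xy) mulr1 addr0 subrr.
Qed.

(** * Expansion in the Phi_k *)

(** Choosing [phi^1] in [k] of the factors leaves [z] in the other [n - k]. *)
Lemma prod_Phi {d n} (X : 'I_n -> finPOrderType d) (z : {poly int}) :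
  \prod_i (refined_coxeter1 (X i) + z * refined_coxeter0 (X i))
    = \sum_(0 <= k < n.+1) z ^+ (n - k) * Phi X k.
Proof.
pose F i (e : bool) := z ^+ (~~ e) * refined_coxeter (X i) e.
have leq_sum_n (e : {ffun 'I_n -> bool}) : (\sum_i e i < n.+1)%N.
  rewrite ltnS -[leqRHS]card_ord -sum1_card.
  by apply: leq_sum => i _; apply: leq_b1.
transitivity (\prod_i \sum_(e : bool) F i e).
  by apply: eq_bigr => i _; rewrite big_bool /F /= mul1r.
rewrite bigA_distr_bigA big_mkord.
rewrite (partition_big (fun e : {ffun _} => Ordinal (leq_sum_n e)) xpredT) //=.
apply: eq_bigr => k _; rewrite /Phi mulr_sumr.
apply: eq_big => [e|e /eqP eq_k]; first by rewrite -val_eqE.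
rewrite /F big_split /=; congr (_ * _).
rewrite -expr_sum; congr (_ ^+ _); rewrite -{}eq_k /=.
apply/eqP; rewrite -(eqn_add2r (\sum_i e i)) subnK //; last exact: leq_sum_n.
rewrite -big_split /= -[X in _ == X]card_ord -sum1_card; apply/eqP.
by apply: eq_bigr => i _; case: (e i).
Qed.

(** The two expansions form a linear system for [r0] and [r1]. Since
    [x r0 - r0] is the sum of the [(x ^ (n - k) - 1) P_k], dividing by [x - 1]
    yields [r0], and the other two quantities are combinations of these sums
    in the same way. The identity is stated over an abstract field, where
    nothing depends on how fractions of polynomials are represented. *)
Lemma refined_of_sums {F : fieldType} (x r0 r1 : F) (n : nat) (P : nat -> F)
    (q := fun m : int => (x ^ m - 1) / (x - 1)) :
    x != 0 -> x - 1 != 0 ->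
    r1 + x * r0 = \sum_(0 <= k < n.+1) x ^+ (n - k) * P k ->
    r1 + r0 = \sum_(0 <= k < n.+1) P k ->
  [/\ r1 + (x + 1) * r0 = \sum_(0 <= k < n.+1) q (n%:Z + 1 - k%:Z) * P k,
      r0 = \sum_(0 <= k < n.+1) q (n%:Z - k%:Z) * P k
    & r1 = \sum_(0 <= k < n.+1) - x * q (n%:Z - 1 - k%:Z) * P k].
Proof.
move=> x_neq0 x1_neq0 sum_x sum_1.
have sum_q a b (c : nat -> F) :
    (forall k, (k <= n)%N -> c k = (a * x ^+ (n - k) - b) / (x - 1)) ->
  \sum_(0 <= k < n.+1) c k * P k
    = (a * (r1 + x * r0) - b * (r1 + r0)) / (x - 1).
  move=> cE; rewrite sum_x sum_1 !mulr_sumr -sumrB mulr_suml.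
  by apply: eq_big_nat => k /andP[_ lt_kn]; rewrite cE //; ring.
split.
- rewrite (sum_q x 1) => [|k le_kn]; first by field.
  by rewrite /q addrAC subzn // addrC -intS -exprnP exprS.
- rewrite (sum_q 1 1) => [|k le_kn]; first by field.
  by rewrite /q subzn // mul1r.
rewrite (sum_q (-1) (- x)) => [|k le_kn]; first by field.
rewrite /q addrAC subzn // expfzDr // exprN1 -exprnP.
by field; rewrite x1_neq0.
Qed.

Lemma tofracX_neq0 : 'X%:F != 0 :> {fraction {poly int}}.
Proof. by rewrite tofrac_eq0 polyX_eq0. Qed.

Lemma tofracX_sub1_neq0 : 'X%:F - 1 != 0 :> {fraction {poly int}}.
Proof. by rewrite -tofrac1 -tofracB tofrac_eq0 polyXsubC_eq0. Qed.

(** The value [- x^-1] at [-1] is the one given by the general quotient, so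
    no case distinction on [m] remains. *)
Lemma vE (m : int) : v m = ('X%:F ^ m - 1) / ('X%:F - 1).
Proof.
have V_sub1 (F : fieldType) (x : F) :
  x != 0 -> x - 1 != 0 -> - x^-1 = (x^-1 - 1) / (x - 1).
  by move=> x0 x1; field; rewrite x1.
rewrite /v; case: eqP => // ->; rewrite exprN1.
exact: V_sub1 tofracX_neq0 tofracX_sub1_neq0.
Qed.

Theorem proposition4p2 (d : Order.disp_t) (n : nat) (hn : (1 <= n)%N)
    (X : 'I_n -> finPOrderType d) :
  [/\ (coxeter_poly (ordinal_sum X))%:F
        = \sum_(0 <= k < n.+1) v (n%:Z + 1 - k%:Z) * (Phi X k)%:F,
      (refined_coxeter0 (ordinal_sum X))%:F
        = \sum_(0 <= k < n.+1) v (n%:Z - k%:Z) * (Phi X k)%:F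
    & (refined_coxeter1 (ordinal_sum X))%:F
        = \sum_(0 <= k < n.+1) - 'X%:F * v (n%:Z - 1 - k%:Z) * (Phi X k)%:F ].
Proof.
have sum_1 : refined_coxeter1 (ordinal_sum X) + refined_coxeter0 (ordinal_sum X)
    = \sum_(0 <= k < n.+1) 1 ^+ (n - k) * Phi X k.
  by rewrite refined_coxeter_mul_1 -prod_Phi; under [RHS]eq_bigr do rewrite mul1r.
have [||E E0 E1] := refined_of_sums 'X%:F (refined_coxeter0 (ordinal_sum X))%:F
  (refined_coxeter1 (ordinal_sum X))%:F n (fun k => (Phi X k)%:F)
  tofracX_neq0 tofracX_sub1_neq0.
- rewrite -tofracM -tofracD refined_coxeter_mul_X prod_Phi rmorph_sum.
  by apply: eq_bigr => k _; rewrite rmorphM rmorphXn.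
- rewrite -tofracD sum_1 rmorph_sum.
  by apply: eq_bigr => k _; rewrite expr1n mul1r.
split.
- rewrite coxeter_poly_refined tofracD tofracM tofracD tofrac1 E.
  by apply: eq_bigr => k _; rewrite vE.
- by rewrite E0; apply: eq_bigr => k _; rewrite vE.
by rewrite E1; apply: eq_bigr => k _; rewrite vE.
Qed.
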